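(* Let $\mathcal{R}$ be a term rewrite system that is non-overlapping and right-linear. Then $\mathrm{dc}_{\xrightarrow{\mathbf{f}}_{\mathcal{R}}}=\mathrm{dc}_{\xrightarrow{\mathbf{i}}_{\Vert\mathcal{R}}}$ and $\mathrm{rc}_{\xrightarrow{\mathbf{f}}_{\mathcal{R}}}=\mathrm{rc}_{\xrightarrow{\mathbf{i}}_{\Vert\mathcal{R}}}$.
   Context: A TRS is a countable set $\mathcal{R}$ of rules $\ell\to r$, $\ell$ non-variable, $\mathcal{V}(r)\subseteq\mathcal{V}(\ell)$. $s\xrightarrow{\mathbf{f}}_{\mathcal{R}}t$ iff $s|_\pi=\ell\sigma$, $t=s[r\sigma]_\pi$ for some position $\pi$, rule, substitution; a redex $\ell\sigma$ is innermost if all its proper subterms are normal forms. Parallel innermost rewriting: $s\xrightarrow{\mathbf{i}}_{\Vert\mathcal{R}}t$ iff there is a nonempty set $\{\pi_1,\dots,\pi_n\}$ of pairwise parallel positions of $s$, each $s|_{\pi_m}$ an innermost redex $\ell_m\sigma_m$ for some rule $\ell_m\to r_m\in\mathcal{R}$, and $t$ is obtained from $s$ by replacing each $s|_{\pi_m}$ by $r_m\sigma_m$. Derivation height $\mathrm{dh}_\to(t)=\sup\{m\mid \exists t'.\ t\to^m t'\}$; size $|x|=1$, $|f(t_1..t_k)|=1+\sum|t_i|$; $\mathrm{dc}_\to(n)=\sup\{\mathrm{dh}_\to(t)\mid|t|\le n\}$; $\mathrm{rc}_\to(n)=\sup\{\mathrm{dh}_\to(t)\mid t$ basic, $|t|\le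 n\}$, where defined symbols are roots of left-hand sides of $\mathcal{R}$, the rest are constructors, and basic terms are $f(t_1,\dots,t_k)$ with $f$ defined and each $t_i$ containing only constructors and variables ($\sup\emptyset=0$). Non-overlapping: no two rules (renamed apart) and non-variable position $\pi$ of $\ell_1$ with $\ell_1|_\pi$ unifiable with $\ell_2$ ($\pi\ne\varepsilon$ if same rule). Right-linear: no variable occurs twice in a right-hand side. *)

(* Defs.v *)
From mathcomp Require Import all_boot.
From mathcomp Require Import boolp classical_sets cardinality.

Set Implicit Arguments.
Unset Strict Implicit.
Unset Printing Implicit Defensive.

Local Open Scope classical_set_scope.

Record signature := Signature { symbol :> Type; arity : symbol -> nat }.

Inductive term (F : signature) :=
| Var of nat
| App (f : F) of {ffun 'I_(arity f) -> term F}.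

Arguments Var {F}.
Arguments App {F}.

Section Terms.
Variable F : signature.
Implicit Types (s t u : term F) (f : F).

(* The automatically generated principle lacks the induction hypotheses for the
   arguments. *)
Lemma term_induction (P : term F -> Prop) :
  (forall x, P (Var x)) ->
  (forall f (ts : {ffun 'I_(arity f) -> term F}),
     (forall i, P (ts i)) -> P (App f ts)) ->
  forall t, P t.
Proof.
move=> PV PA; fix IH 1 => -[x|f ts]; first exact: PV.
by apply: PA => i; exact: IH.
Qed.

Fixpoint tsize t : nat :=
  match t with
  | Var _ => 1
  | App _ ts => (\sum_i tsize (ts i)).+1
  end.

(* All variable occurrences from left to right, with repetitions. *)
Fixpoint vars t : seq nat :=
  match t with
  | Var x => [:: x]
  | App _ ts => \big[cat/[::]]_i vars (ts i)
  end.

Definition is_var t : bool := if t is Var _ then true else false.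

Definition substitution := nat -> term F.

Fixpoint subst (sigma : substitution) t : term F :=
  match t with
  | Var x => sigma x
  | App f ts => App f [ffun i => subst sigma (ts i)]
  end.

(* Arguments are numbered from 0. *)
Definition position := seq nat.

(* None if p is not a position of t. *)
Fixpoint subterm_at t (p : position) : option (term F) :=
  match p, t with
  | [::], _ => Some t
  | _ :: _, Var _ => None
  | k :: p', App f ts =>
      if (insub k : option 'I_(arity f)) is Some i
      then subterm_at (ts i) p' else None
  end.

(* t[u]_p; only meaningful when p is a position of t. *)
Fixpoint replace_at t (p : position) u : term F :=
  match p, t with
  | [::], _ => u
  | _ :: _, Var _ => t
  | k :: p', App f ts =>
      App f [ffun i => if nat_of_ord i == k
                       then replace_at (ts i) p' u else ts i]
  end.

Definition parallel (p q : position) : bool := ~~ prefix p q && ~~ prefix q p.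

Record rule := Rule { lhs : term F; rhs : term F }.

Record trs := TRS {
  rules : set rule;
  trs_countable : countable rules;
  trs_lhs_nonvar : forall rho, rules rho -> ~~ is_var (lhs rho);
  trs_vars : forall rho, rules rho -> {subset vars (rhs rho) <= vars (lhs rho)}
}.

Definition full_step (R : trs) s t : Prop :=
  exists (p : position) (rho : rule) (sigma : substitution),
    [/\ rules R rho, subterm_at s p = Some (subst sigma (lhs rho)) &
        t = replace_at s p (subst sigma (rhs rho))].

Definition normal_form (R : trs) s : Prop := ~ exists t, full_step R s t.

Definition proper_subterms_normal (R : trs) s : Prop :=
  forall p u, p != [::] -> subterm_at s p = Some u -> normal_form R u.

(* The order in which the redexes are replaced is immaterial, the positions being
   pairwise parallel. *)
Definition parallel_innermost_step (R : trs) s t : Prop :=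
  exists (n : nat) (p : 'I_n -> position) (rho : 'I_n -> rule)
         (sigma : 'I_n -> substitution),
    [/\ 0 < n,
        forall i j, i != j -> parallel (p i) (p j),
        forall i, [/\ rules R (rho i),
                      subterm_at s (p i) = Some (subst (sigma i) (lhs (rho i))) &
                      proper_subterms_normal R
                        (subst (sigma i) (lhs (rho i)))] &
        t = foldl
              (fun u i => replace_at u (p i) (subst (sigma i) (rhs (rho i))))
              s (enum 'I_n)].

Definition unifiable s t : Prop :=
  exists mu : substitution, subst mu s = subst mu t.

Definition rename (tau : nat -> nat) t : term F :=
  subst (fun x => Var (tau x)) t.

(* Renaming one of the two rules is enough to make them variable-disjoint; the
   right-hand sides contribute no further variables. *)
Definition renames_apart (tau : nat -> nat) (rho1 rho2 : rule) : Prop :=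
  bijective tau /\
  forall x, x \in vars (lhs rho1) -> x \notin vars (rename tau (lhs rho2)).

Definition overlap (rho1 rho2 : rule) : Prop :=
  exists (tau : nat -> nat) (p : position) u,
    [/\ renames_apart tau rho1 rho2,
        subterm_at (lhs rho1) p = Some u,
        ~~ is_var u,
        rho1 = rho2 -> p != [::] &
        unifiable u (rename tau (lhs rho2))].

Definition non_overlapping (R : trs) : Prop :=
  forall rho1 rho2, rules R rho1 -> rules R rho2 -> ~ overlap rho1 rho2.

Definition right_linear (R : trs) : Prop :=
  forall rho, rules R rho -> uniq (vars (rhs rho)).

Definition defined_symbol (R : trs) f : Prop :=
  exists rho ts, rules R rho /\ lhs rho = App f ts.

Fixpoint constructor_term (R : trs) t : Prop :=
  match t with
  | Var _ => True
  | App f ts => ~ defined_symbol R f /\ forall i, constructor_term R (ts i)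
  end.

Definition basic (R : trs) t : Prop :=
  match t with
  | Var _ => False
  | App f ts => defined_symbol R f /\ forall i, constructor_term R (ts i)
  end.

End Terms.

(* The natural numbers extended by omega, represented by None. *)
Definition enat := option nat.

Definition ele (x y : enat) : bool :=
  match x, y with
  | _, None => true
  | None, Some _ => false
  | Some m, Some n => m <= n
  end.

Definition efinite_ub (A : set enat) : pred nat :=
  fun n => `[< forall x, A x -> ele x (Some n) >].

(* The least upper bound in enat, see esup_ub and esup_least; 0 on the empty set. *)
Definition esup (A : set enat) : enat :=
  if pselect (exists n, efinite_ub A n) is left h then Some (ex_minn h) else None.

Lemma esup_ub (A : set enat) x : A x -> ele x (esup A).
Proof.
rewrite /esup => Ax; case: pselect => [h|_]; last by case: x Ax.
by case: ex_minnP => n /asboolP ub _; exact: ub.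
Qed.

Lemma esup_least (A : set enat) y : (forall x, A x -> ele x y) -> ele (esup A) y.
Proof.
rewrite /esup => ub; case: pselect => [h|h].
  case: y ub => [n|//] ub; case: ex_minnP => m _ mmin /=.
  by apply: mmin; exact/asboolP.
by case: y ub => // n ub; case: h; exists n; apply/asboolP.
Qed.

Lemma esup0 : esup set0 = Some 0.
Proof.
have := @esup_least set0 (Some 0) (fun x h => False_ind _ h).
by case: (esup set0) => [[]|].
Qed.

Fixpoint nsteps (T : Type) (r : T -> T -> Prop) (m : nat) (s t : T) : Prop :=
  if m is m'.+1 then exists u, r s u /\ nsteps r m' u t else s = t.

Definition dh (T : Type) (r : T -> T -> Prop) (t : T) : enat :=
  esup [set Some m | m in [set m | exists t', nsteps r m t t']].

Definition dc (F : signature) (r : term F -> term F -> Prop) (n : nat) : enat :=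
  esup [set dh r t | t in [set t | tsize t <= n]].

Definition rc (F : signature) (R : trs F) (r : term F -> term F -> Prop)
    (n : nat) : enat :=
  esup [set dh r t | t in [set t | basic R t /\ tsize t <= n]].

(* Main.v *)
From mathcomp Require Import all_boot.
From mathcomp Require Import boolp classical_sets.
Require Import Defs.

(** Innermost steps of a non-overlapping system have the diamond property, so
    every innermost derivation from [s] to [w] has the same length and every
    innermost reduct of [s] loses exactly the number of steps spent so far.
    It is then enough to show that a full step [s -> t] strictly decreases the
    innermost derivation height.  For a redex [l sigma], either some
    [sigma x] with [x] in [l] has innermost derivations of any length, or
    [sigma] normalizes innermost to some [sigma'].  In the latter case
    [l sigma ->* l sigma' -> r sigma'], the last step being innermost by
    non-overlappingness, while [r sigma ->* r sigma'] takes no more steps than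
    [l sigma ->* l sigma'] because [r] is linear and its variables are in [l].
    Parallel innermost steps lie between single innermost steps and nonempty
    sequences of full steps. *)

Set Implicit Arguments.
Unset Strict Implicit.
Unset Printing Implicit Defensive.

(** * Counted reduction sequences *)

Section Nsteps.
Variables (T : Type) (r : T -> T -> Prop).
Implicit Types s t u : T.

Definition has_steps s n := exists t, nsteps r n s t.

Lemma nsteps_trans m n s t u :
  nsteps r m s t -> nsteps r n t u -> nsteps r (m + n) s u.
Proof.
elim: m s => [|m IH] s /=; first by move=> ->.
by move=> [v [sv vt]] tu; exists v; split => //; exact: IH.
Qed.

Lemma nsteps_split m n s u : nsteps r (m + n) s u ->
  exists2 t, nsteps r m s t & nsteps r n t u.
Proof.
elim: m s => [|m IH] s /=; first by exists s.
by move=> [v [sv /IH[t vt tu]]]; exists t => //; exists v.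
Qed.

Lemma nsteps1 s t : r s t -> nsteps r 1 s t.
Proof. by exists t. Qed.

Lemma has_steps_leq m n s : m <= n -> has_steps s n -> has_steps s m.
Proof.
by move=> le_mn [u]; rewrite -(subnKC le_mn) => /nsteps_split[t st _]; exists t.
Qed.

Lemma has_steps_trans m n s t :
  nsteps r m s t -> has_steps t n -> has_steps s (m + n).
Proof. by move=> st [u tu]; exists u; exact: nsteps_trans tu. Qed.

(** A peak closes with exactly one step on each side unless it is trivial. This keeps derivation
    lengths comparable, which confluence alone would not. *)
Definition diamond := forall s t1 t2, r s t1 -> r s t2 ->
  t1 = t2 \/ exists2 u, r t1 u & r t2 u.

(** Close the peak between the given step and the first step of the long derivation. The induction
    hypothesis then moves the rest of that derivation over to the common reduct. *)
Lemma diamond_has_steps_step s t n :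
  diamond -> r s t -> has_steps s n.+1 -> has_steps t n.
Proof.
move=> dia; elim: n s t => [|n IH] s t st; first by exists t.
move=> [u [v [sv vu]]].
have [->|[w tw vw]] := dia _ _ _ st sv; first by exists u.
by apply: (has_steps_trans (nsteps1 tw)); apply: IH vw _; exists u.
Qed.

Lemma diamond_has_steps m n s t :
  diamond -> nsteps r m s t -> has_steps s (m + n) -> has_steps t n.
Proof.
move=> dia; elim: m s => [|m IH] s /=; first by move=> ->.
by move=> [u [su ut]] /(diamond_has_steps_step dia su); exact: IH.
Qed.

(** Classical: if no derivation reaches an irreducible term, every derivation can be prolonged. *)
Lemma normalizes_or_has_steps s :
  (exists n t, nsteps r n s t /\ ~ exists u, r t u) \/ forall n, has_steps s n.
Proof.
have [?|nonorm] := pselect (exists n t, nsteps r n s t /\ ~ exists u, r t u).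
  by left.
right; elim=> [|n [t st]]; first by exists s.
have [[u tu]|nf_t] := pselect (exists u, r t u); last by case: nonorm; exists n, t.
by exists u; rewrite -addn1; apply: nsteps_trans st (nsteps1 tu).
Qed.

End Nsteps.

(** Meant for [r1] the variables of a linear right-hand side and [r2] those of the left-hand side,
    which may repeat. *)
Lemma leq_sum_uniq_sub (I : eqType) (k : I -> nat) (r1 r2 : seq I) :
  uniq r1 -> {subset r1 <= r2} -> \sum_(x <- r1) k x <= \sum_(x <- r2) k x.
Proof.
elim: r1 r2 => [|x r1 IH] r2; first by rewrite big_nil.
move=> /andP[xNr1 u1] sub; rewrite big_cons.
rewrite (perm_big _ (perm_to_rem (sub x (mem_head _ _)))) big_cons leq_add2l.
apply: IH => // y yr1; have := sub y; rewrite inE yr1 orbT => /(_ isT).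
rewrite (perm_mem (perm_to_rem (sub x (mem_head _ _)))) inE => /predU1P[yx|//].
by rewrite -yx yr1 in xNr1.
Qed.

(** * Closure under contexts *)

Section Contexts.
Variable F : signature.
Implicit Types (s t u v : term F) (Q : term F -> term F -> Prop).

Definition update n (ts : {ffun 'I_n -> term F}) i u : {ffun 'I_n -> term F} :=
  [ffun j => if j == i then u else ts j].

Lemma update_update n (ts : {ffun 'I_n -> term F}) i u v :
  update (update ts i u) i v = update ts i v.
Proof. by apply/ffunP => j; rewrite !ffunE; case: eqP. Qed.

Lemma update_comm n (ts : {ffun 'I_n -> term F}) i j u v : i != j ->
  update (update ts i u) j v = update (update ts j v) i u.
Proof.
move=> ij; apply/ffunP => k; rewrite !ffunE.
by case: (eqVneq k j) => [->|//]; rewrite eq_sym (negPf ij).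
Qed.

Lemma update_id n (ts : {ffun 'I_n -> term F}) i : update ts i (ts i) = ts.
Proof. by apply/ffunP => j; rewrite !ffunE; case: eqP => [->|]. Qed.

(** A position-free form of rewriting inside a term, suited to structural induction; [ctxP] links it
    to positions. *)
Inductive ctx Q : term F -> term F -> Prop :=
| ctx_root s t : Q s t -> ctx Q s t
| ctx_arg f (ts : {ffun 'I_(arity f) -> term F}) i u :
    ctx Q (ts i) u -> ctx Q (App f ts) (App f (update ts i u)).

Lemma ctx_inv Q s t : ctx Q s t -> Q s t \/
  match s with
  | Var _ => False
  | App f ts => exists i u, ctx Q (ts i) u /\ t = App f (update ts i u)
  end.
Proof. by case=> [? ? ?|f ts i u tsu]; [left | right; exists i, u]. Qed.

Lemma subterm_at_nil s : subterm_at s [::] = Some s.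
Proof. by case: s. Qed.

Lemma replace_at_nil s v : replace_at s [::] v = v.
Proof. by case: s. Qed.

Lemma ctxP Q s t : ctx Q s t <->
  exists p u v, [/\ Q u v, subterm_at s p = Some u & t = replace_at s p v].
Proof.
split.
- elim=> {s t} [s t Qst|f ts i u _ [p [v [w [Qvw eq_v ->]]]]].
    by exists [::], s, t; rewrite subterm_at_nil replace_at_nil.
  exists (val i :: p), v, w; split=> //=; first by rewrite valK.
  congr App; apply/ffunP => j; rewrite !ffunE.
  by rewrite -(inj_eq val_inj) /=; case: eqP => // /val_inj ->.
- move=> [p [u [v [Quv]]]]; elim: p s t => [|k p IH] s t /=.
    by rewrite subterm_at_nil replace_at_nil => -[->] ->; exact: ctx_root.
  case: s => //= f ts; case: insubP => // i _ vi eq_u ->.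
  have -> : [ffun j : 'I__ => if val j == k then replace_at (ts j) p v else ts j]
              = update ts i (replace_at (ts i) p v).
    apply/ffunP => j; rewrite !ffunE -vi (inj_eq val_inj).
    by case: eqP => [->|].
  exact/ctx_arg/IH.
Qed.

Lemma ctx_subterm Q s p u v :
  subterm_at s p = Some u -> ctx Q u v -> exists t, ctx Q s t.
Proof.
elim: p s => [|k p IH] s /=.
  by rewrite subterm_at_nil => -[->] uv; exists v.
case: s => //= f ts; case: insubP => // i _ _ /IH {}IH /IH[t tst].
by exists (App f (update ts i t)); exact: ctx_arg.
Qed.

Lemma nsteps_arg Q n f (ts : {ffun 'I_(arity f) -> term F}) i u :
  nsteps (ctx Q) n (ts i) u ->
  nsteps (ctx Q) n (App f ts) (App f (update ts i u)).
Proof.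
elim: n ts => [|n IH] ts /=; first by move=> <-; rewrite update_id.
move=> [v [tsv vu]]; exists (App f (update ts i v)); split; first exact: ctx_arg.
by rewrite -(update_update ts i v u); apply: IH; rewrite ffunE eqxx.
Qed.

Lemma nsteps_args Q f (ts us : {ffun 'I_(arity f) -> term F}) m :
  (forall i, nsteps (ctx Q) (m i) (ts i) (us i)) ->
  nsteps (ctx Q) (\sum_i m i) (App f ts) (App f us).
Proof.
move=> tsus.
(* With a list of already rewritten indices in place of the full enumeration, induction on the list
   rewrites one argument at a time. *)
have -> : us = [ffun j => if j \in index_enum 'I_(arity f) then us j else ts j].
  by apply/ffunP => j; rewrite ffunE mem_index_enum.
elim: (index_enum _) (index_enum_uniq 'I_(arity f)) => [_|i r IH /andP[iNr ur]].
  by rewrite big_nil /=; congr App; apply/ffunP => j; rewrite ffunE.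
rewrite big_cons addnC; apply: nsteps_trans (IH ur) _.
set ws := [ffun j => if j \in r then _ else _].
have -> : [ffun j => if j \in i :: r then us j else ts j] = update ws i (us i).
  by apply/ffunP => j; rewrite !ffunE inE; case: eqP => [->|].
by apply: nsteps_arg; rewrite ffunE (negPf iNr).
Qed.

(** * Substitutions and positions *)

Lemma mem_vars_App x f (ts : {ffun 'I_(arity f) -> term F}) :
  x \in vars (App f ts) <-> exists i, x \in vars (ts i).
Proof.
rewrite /=; have -> : (exists i, x \in vars (ts i)) <->
                      exists2 i, i \in index_enum 'I_(arity f) & x \in vars (ts i).
  by split=> [[i ?]|[i _ ?]]; exists i => //; rewrite mem_index_enum.
elim: (index_enum _) => [|i r IH]; first by rewrite big_nil; split=> // -[].
rewrite big_cons mem_cat; split.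
  case/orP => [xi|/IH[j jr xj]]; first by exists i; rewrite ?mem_head.
  by exists j => //; rewrite inE jr orbT.
move=> [j]; rewrite inE => /predU1P[->|jr] xj; first by rewrite xj.
by apply/orP; right; apply/IH; exists j.
Qed.

Lemma sum_vars_App (k : nat -> nat) f (ts : {ffun 'I_(arity f) -> term F}) :
  \sum_(x <- vars (App f ts)) k x = \sum_i \sum_(x <- vars (ts i)) k x.
Proof.
rewrite /= (big_morph (fun xs => \sum_(x <- xs) k x) (id1 := 0) (op1 := addn)) //.
  by move=> xs ys; rewrite big_cat.
by rewrite big_nil.
Qed.

Lemma subterm_at_vars s p u :
  subterm_at s p = Some u -> {subset vars u <= vars s}.
Proof.
elim: p s => [|k p IH] s /=.
  by rewrite !subterm_at_nil => -[->].
case: s => //= f ts; case: insubP => // i _ _ /IH sub x /sub xi.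
by apply/mem_vars_App; exists i.
Qed.

Lemma subterm_at_subst s p u (sigma : substitution F) :
  subterm_at s p = Some u -> subterm_at (subst sigma s) p = Some (subst sigma u).
Proof.
elim: p s => [|k p IH] s /=.
  by rewrite !subterm_at_nil => -[->].
by case: s => // f ts /=; case: insubP => // i _ _ /IH; rewrite ffunE.
Qed.

Lemma mem_vars_subterm_at s x :
  x \in vars s -> exists p, subterm_at s p = Some (Var x).
Proof.
elim/term_induction: s => [y|f ts IH].
  by rewrite inE => /eqP->; exists [::].
by move=> /mem_vars_App[i /IH[p eq_p]]; exists (val i :: p); rewrite /= valK.
Qed.

Lemma eq_subst s (sigma tau : substitution F) :
  {in vars s, sigma =1 tau} -> subst sigma s = subst tau s.
Proof.
elim/term_induction: s => [x|f ts IH] eq_st /=.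
  by apply: eq_st; rewrite inE.
congr App; apply/ffunP => i; rewrite !ffunE; apply: IH => x xi; apply: eq_st.
by apply/mem_vars_App; exists i.
Qed.

Lemma subst_inj s (sigma tau : substitution F) :
  subst sigma s = subst tau s -> {in vars s, sigma =1 tau}.
Proof.
move=> eq_st x /mem_vars_subterm_at[p eq_p].
have := subterm_at_subst sigma eq_p; rewrite eq_st (subterm_at_subst tau eq_p).
by move=> [].
Qed.

Lemma subst_rename (sigma : substitution F) (tau : nat -> nat) s :
  subst sigma (rename tau s) = subst (fun x => sigma (tau x)) s.
Proof.
elim/term_induction: s => [//|f ts IH] /=.
by congr App; apply/ffunP => i; rewrite !ffunE; exact: IH.
Qed.

Lemma nsteps_subst Q (sigma tau : substitution F) (k : nat -> nat) s :
  (forall x, x \in vars s -> nsteps (ctx Q) (k x) (sigma x) (tau x)) ->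
  nsteps (ctx Q) (\sum_(x <- vars s) k x) (subst sigma s) (subst tau s).
Proof.
elim/term_induction: s => [x|f ts IH] st.
  by rewrite big_seq1; apply: st; rewrite inE.
rewrite sum_vars_App; apply: nsteps_args => i; rewrite !ffunE; apply: IH => x xi.
by apply: st; apply/mem_vars_App; exists i.
Qed.

Lemma has_steps_subst Q (sigma : substitution F) s x n :
  x \in vars s -> has_steps (ctx Q) (sigma x) n ->
  has_steps (ctx Q) (subst sigma s) n.
Proof.
elim/term_induction: s => [y|f ts IH]; first by rewrite inE => /eqP->.
move=> /mem_vars_App[i xi] /(IH _ xi)[u stepsu].
by exists (App f (update [ffun i => subst sigma (ts i)] i u));
  apply: nsteps_arg; rewrite ffunE.
Qed.

Lemma subterm_at_replace_at s p q v :
  parallel p q -> subterm_at (replace_at s p v) q = subterm_at s q.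
Proof.
elim: p q s => [|a p IH] [|b q] s //=.
case: s => // f ts par /=; case: insubP => //= i _ vi; rewrite ffunE vi.
case: eqP => // ba; apply: IH.
by move: par; rewrite ba /parallel /= eqxx.
Qed.

End Contexts.

(** * Overlaps *)

Section Overlap.
Variable F : signature.
Implicit Types (s t u v : term F) (rho : rule F).

(** Exchanges the intervals [[0, N)] and [[N, 2N)]; being an involution, it is a bijective
    renaming. *)
Definition swap_blocks N x :=
  if x < N then x + N else if x < N + N then x - N else x.

Lemma swap_blocksK N : involutive (swap_blocks N).
Proof.
move=> x; rewrite /swap_blocks; case: (ltnP x N) => xN.
  by rewrite ltnNge leq_addl /= ltn_add2r xN addnK.
case: (ltnP x (N + N)) => xNN; first by rewrite ltn_subLR // xNN subnK.
by rewrite ltnNge xN ltnNge xNN.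
Qed.

Lemma mem_vars_rename (tau : nat -> nat) s x :
  x \in vars (rename tau s) -> exists2 y, y \in vars s & x = tau y.
Proof.
elim/term_induction: s => [y|f ts IH].
  by rewrite inE => /eqP->; exists y; rewrite ?inE.
move=> /mem_vars_App[i]; rewrite ffunE => /IH[y yi ->]; exists y => //.
by apply/mem_vars_App; exists i.
Qed.

(** After renaming apart, the two substitutions act on disjoint variables and can be glued into one
    unifier. *)
Lemma common_instance_overlap rho1 rho2 p u (sigma1 sigma2 : substitution F) :
  subterm_at (lhs rho1) p = Some u -> ~~ is_var u ->
  (rho1 = rho2 -> p != [::]) ->
  subst sigma1 u = subst sigma2 (lhs rho2) -> overlap rho1 rho2.
Proof.
move=> eq_p uNvar pN0 inst.
(* [N] exceeds every variable of both left-hand sides. *)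
pose N := (\max_(x <- vars (lhs rho1) ++ vars (lhs rho2)) x).+1.
have ltN x : x \in vars (lhs rho1) ++ vars (lhs rho2) -> x < N.
  by move=> xin; rewrite ltnS; exact: (leq_bigmax_seq (F := id)).
have lt1 x : x \in vars (lhs rho1) -> x < N.
  by move=> xin; apply: ltN; rewrite mem_cat xin.
have lt2 x : x \in vars (lhs rho2) -> x < N.
  by move=> xin; apply: ltN; rewrite mem_cat xin orbT.
exists (swap_blocks N), p, u; split=> //.
  split; first by exists (swap_blocks N); exact: swap_blocksK.
  move=> x /lt1 xN; apply/negP => /mem_vars_rename[y /lt2 yN eq_x].
  by move: xN; rewrite eq_x /swap_blocks yN ltnNge leq_addl.
exists (fun x => if x < N then sigma1 x else sigma2 (swap_blocks N x)).
rewrite subst_rename; transitivity (subst sigma1 u).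
  by apply: eq_subst => x /(subterm_at_vars eq_p) /lt1 ->.
rewrite inst; apply: eq_subst => x /lt2 xN.
by rewrite swap_blocksK /swap_blocks xN ltnNge leq_addl.
Qed.

End Overlap.

(** * Innermost rewriting *)

Section Innermost.
Variables (F : signature) (R : trs F).
Implicit Types (s t u v : term F) (rho : rule F).

Definition contracts s t := exists rho (sigma : substitution F),
  [/\ rules R rho, s = subst sigma (lhs rho) & t = subst sigma (rhs rho)].

(** Checking the immediate arguments suffices, since subterms of normal forms are normal. *)
Definition args_normal s :=
  match s with
  | Var _ => True
  | App _ ts => forall i, normal_form R (ts i)
  end.

Definition innermost_contracts s t := contracts s t /\ args_normal s.

Definition innermost_step := ctx innermost_contracts.

Lemma full_stepP s t : full_step R s t <-> ctx contracts s t.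
Proof.
split=> [[p [rho [sigma [Rrho eq_p ->]]]]|/ctxP[p [u [v [[rho [sigma [Rrho -> ->]]]]]]]].
  apply/ctxP; exists p, (subst sigma (lhs rho)), (subst sigma (rhs rho)).
  by split=> //; exists rho, sigma.
by move=> eq_p ->; exists p, rho, sigma.
Qed.

Lemma normal_form_subterm s p u :
  normal_form R s -> subterm_at s p = Some u -> normal_form R u.
Proof.
move=> nf eq_p [v /full_stepP uv]; case: nf.
by have [t st] := ctx_subterm eq_p uv; exists t; apply/full_stepP.
Qed.

Lemma args_normal_proper s : args_normal s -> proper_subterms_normal R s.
Proof.
case: s => [x _|f ts nf_ts] [|k p] u //= _.
by case: insubP => // i _ _; exact: normal_form_subterm.
Qed.

(** Without innermost steps the arguments are normal by induction, so a redex at the root would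
    itself be innermost. *)
Lemma not_innermost_step_normal s :
  ~ (exists t, innermost_step s t) -> normal_form R s.
Proof.
elim/term_induction: s => [x|f ts IH] noi [t /full_stepP /ctx_inv].
  by case=> // xt; apply: noi; exists t; apply: ctx_root.
have nf_ts i : normal_form R (ts i).
  apply: IH => -[u tsu]; apply: noi; exists (App f (update ts i u)).
  exact: ctx_arg.
case=> [st|[i [u [tsu _]]]]; first by apply: noi; exists t; apply: ctx_root.
by apply: (nf_ts i); exists u; apply/full_stepP.
Qed.

Lemma normal_not_innermost_step s t : normal_form R s -> ~ innermost_step s t.
Proof.
move=> nf /ctxP[p [u [v [[uv _] eq_p _]]]]; apply: nf.
have [w sw] := ctx_subterm eq_p (ctx_root uv).
by exists w; apply/full_stepP.
Qed.

Lemma innermost_step_parallel s t :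
  innermost_step s t -> parallel_innermost_step R s t.
Proof.
move=> /ctxP[p [u [v [[[rho [sigma [Rrho eq_u eq_v]]] anf] eq_p ->]]]].
exists 1, (fun=> p), (fun=> rho), (fun=> sigma); split=> //.
- by move=> i j; rewrite !ord1.
- by move=> _; rewrite -eq_u; split=> //; exact: args_normal_proper.
- by rewrite enum_ordSl -eq_v [enum 'I_0](size0nil (size_enum_ord 0)).
Qed.

(** Contracting one redex leaves the redexes at parallel positions intact, so they can be contracted
    one after the other. *)
Lemma parallel_innermost_step_full s t :
  parallel_innermost_step R s t ->
  exists n, nsteps (full_step R) n.+1 s t.
Proof.
move=> [[|n] [p [rho [sigma [// _ par redex ->]]]]]; exists n.
(* The number of steps becomes the length of the list of indices, on which the induction runs. *)
rewrite -{1}(size_enum_ord n.+1).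
have : forall i, i \in enum 'I_n.+1 ->
    subterm_at s (p i) = Some (subst (sigma i) (lhs (rho i))).
  by move=> i _; case: (redex i).
elim: (enum 'I_n.+1) (enum_uniq 'I_n.+1) s {redex}(fun i => let: And3 Ri _ _ := redex i in Ri)
  => [//|i r IH] /andP[iNr ur] s Rrho eq_s /=.
eexists; split.
  by exists (p i), (rho i), (sigma i); split=> //; apply: eq_s; rewrite mem_head.
apply: IH => // j jr; rewrite subterm_at_replace_at.
  by apply: eq_s; rewrite inE jr orbT.
by apply: par; apply: contraNneq iNr => ->.
Qed.

(** * Determinism and the diamond property from non-overlappingness *)

Hypothesis R_non_overlapping : non_overlapping R.

(** Distinct rules would overlap at the root. For a single rule, matching fixes the substitution on
    the left-hand side, hence on the right-hand side. *)
Lemma contracts_det s t1 t2 : contracts s t1 -> contracts s t2 -> t1 = t2.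
Proof.
move=> [rho1 [sigma1 [R1 -> ->]]] [rho2 [sigma2 [R2 eq_s ->]]].
have eq_rho : rho1 = rho2.
  apply: contrapT => neq; apply: (R_non_overlapping R1 R2).
  apply: (common_instance_overlap (subterm_at_nil _) _ _ eq_s) => //.
  exact: trs_lhs_nonvar R1.
rewrite -{}eq_rho {rho2 R2} in eq_s *; apply: eq_subst => x /(trs_vars R1).
exact: subst_inj.
Qed.

(** A root contraction requires normal arguments and so excludes steps inside them. Steps in
    distinct arguments commute, and those in the same argument are joined by induction. *)
Lemma innermost_diamond : diamond innermost_step.
Proof.
elim/term_induction => [x|f ts IH] t1 t2 /ctx_inv + /ctx_inv.
  by move=> [[c1 _]|//] [[c2 _]|//]; left; exact: contracts_det c2.
move=> [[c1 nf1]|[i [u [su ->]]]] [[c2 nf2]|[j [v [sv ->]]]].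
- by left; exact: contracts_det c2.
- by case: (normal_not_innermost_step (nf1 j) sv).
- by case: (normal_not_innermost_step (nf2 i) su).
case: (eqVneq i j) => [eq_ij|ij].
  rewrite -eq_ij in sv *.
  have [->|[w uw vw]] := IH _ _ _ su sv; first by left.
  right; exists (App f (update ts i w)).
    by rewrite -(update_update ts i u w); apply: ctx_arg; rewrite ffunE eqxx.
  by rewrite -(update_update ts i v w); apply: ctx_arg; rewrite ffunE eqxx.
right; exists (App f (update (update ts i u) j v)).
  by apply: ctx_arg; rewrite ffunE eq_sym (negPf ij).
by rewrite update_comm //; apply: ctx_arg; rewrite ffunE (negPf ij).
Qed.

(** A redex of the instance lies either within some [sigma x] or at a non-variable position of
    [u]. *)
Lemma subst_normal_form (sigma : substitution F) u :
  (forall x, x \in vars u -> normal_form R (sigma x)) ->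
  (forall p v, subterm_at u p = Some v -> ~~ is_var v ->
     ~ exists t, contracts (subst sigma v) t) ->
  normal_form R (subst sigma u).
Proof.
elim/term_induction: u => [x|f us IH] nf_sigma irred.
  by apply: nf_sigma; rewrite inE.
move=> [t /full_stepP /ctx_inv[ct|]].
  by apply: (irred [::] (App f us)) => //; exists t.
move=> [i [w [+ _]]]; rewrite ffunE => iw.
apply: (IH i); last by exists w; apply/full_stepP.
  by move=> x xi; apply: nf_sigma; apply/mem_vars_App; exists i.
by move=> p v eq_v; apply: (irred (val i :: p)); rewrite /= valK.
Qed.

Lemma innermost_redex rho (sigma : substitution F) : rules R rho ->
  (forall x, x \in vars (lhs rho) -> normal_form R (sigma x)) ->
  innermost_step (subst sigma (lhs rho)) (subst sigma (rhs rho)).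
Proof.
move=> Rrho nf_sigma; apply: ctx_root; split; first by exists rho, sigma.
case eq_l: (lhs rho) => [x|f ls].
  by have := trs_lhs_nonvar Rrho; rewrite eq_l.
move=> i; rewrite ffunE; apply: subst_normal_form.
  by move=> x xi; apply: nf_sigma; rewrite eq_l; apply/mem_vars_App; exists i.
move=> p v eq_v vNvar [t [rho' [sigma' [Rrho' eq_s _]]]].
apply: (R_non_overlapping Rrho Rrho').
(* The position is below the root, so this is an overlap even when [rho'] equals [rho]. *)
apply: (common_instance_overlap (p := val i :: p) _ vNvar _ eq_s) => //.
by rewrite eq_l /= valK.
Qed.

(** * Full steps shorten innermost derivations *)

Hypothesis R_right_linear : right_linear R.

(* Unlike a comparison of derivation heights, this invariant is preserved when
   the step is put into a context. *)
Definition joins_longer s t := (forall n, has_steps innermost_step s n) \/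
  exists m n u, [/\ m < n, nsteps innermost_step m t u &
                    nsteps innermost_step n s u].

Lemma contracts_joins_longer s t : contracts s t -> joins_longer s t.
Proof.
move=> [rho [sigma [Rrho -> ->]]].
have [[x xl xinf]|fin] := pselect (exists2 x, x \in vars (lhs rho) &
    forall n, has_steps innermost_step (sigma x) n).
  by left=> n; apply: has_steps_subst xl (xinf n).
(* Made total for [choice]: variables outside the left-hand side get a dummy pair. *)
have norm x : exists kt : nat * term F, x \in vars (lhs rho) ->
    nsteps innermost_step kt.1 (sigma x) kt.2 /\ normal_form R kt.2.
  have [xl|xNl] := boolP (x \in vars (lhs rho)); last by exists (0, Var x).
  have [[k [v [sv nf]]]|xinf] := normalizes_or_has_steps innermost_step (sigma x).
    by exists (k, v) => _; split=> //; exact: not_innermost_step_normal.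
  by case: fin; exists x.
have [kt ktP] := choice norm.
pose sigma' x := (kt x).2.
(* Each variable occurrence costs the steps normalizing its value; the successor counts the final
   contraction at the root. *)
right; exists (\sum_(x <- vars (rhs rho)) (kt x).1),
  (\sum_(x <- vars (lhs rho)) (kt x).1).+1, (subst sigma' (rhs rho)); split.
- by rewrite ltnS; apply: leq_sum_uniq_sub (R_right_linear Rrho) (trs_vars Rrho).
- by apply: nsteps_subst => x /(trs_vars Rrho)/ktP[].
rewrite -addn1; apply: nsteps_trans (nsteps1 _); first last.
  by apply: innermost_redex => // x /ktP[].
by apply: nsteps_subst => x /ktP[].
Qed.

Lemma full_step_joins_longer s t : full_step R s t -> joins_longer s t.
Proof.
move=> /full_stepP; elim=> {s t} [s t|f ts i u _].
  exact: contracts_joins_longer.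
case=> [inf|[m [n [w [lt_mn uw tsw]]]]].
  left=> n; have [w tsw] := inf n.
  by exists (App f (update ts i w)); exact: nsteps_arg.
right; exists m, n, (App f (update ts i w)); split=> //; last exact: nsteps_arg.
by rewrite -(update_update ts i u w); apply: nsteps_arg; rewrite ffunE eqxx.
Qed.

(** If [n <= m], the [k > m] steps from [s] to [u] suffice. Otherwise the diamond property leaves
    [n - m] steps from [u], and [k + (n - m)] is at least [n + 1]. *)
Lemma full_step_has_steps s t n : full_step R s t ->
  has_steps innermost_step t n -> has_steps innermost_step s n.+1.
Proof.
move=> /full_step_joins_longer[inf _|[m [k [u [lt_mk tu su]]]] tn]; first exact: inf.
have [le_nm|/ltnW le_mn] := leqP n m.
  by apply: (has_steps_leq (n := k)); [exact: leq_ltn_trans le_nm lt_mk | exists u].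
have un : has_steps innermost_step u (n - m).
  by apply: diamond_has_steps innermost_diamond tu _; rewrite subnKC.
by apply: has_steps_leq (has_steps_trans su un); rewrite -{1}(subnKC le_mn) -addSn leq_add2r.
Qed.

Lemma has_steps_full_innermost s n :
  has_steps (full_step R) s n -> has_steps innermost_step s n.
Proof.
elim: n s => [|n IH] s; first by exists s.
by move=> [t [u [su ut]]]; apply: full_step_has_steps su _; apply: IH; exists t.
Qed.

(** * Comparison of innermost, parallel innermost and full derivation lengths *)

Lemma has_steps_innermost_parallel s n :
  has_steps innermost_step s n -> has_steps (parallel_innermost_step R) s n.
Proof.
elim: n s => [|n IH] s; first by exists s.
move=> [t [u [su ut]]]; rewrite -add1n.
apply: has_steps_trans (nsteps1 (innermost_step_parallel su)) _.
by apply: IH; exists t.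
Qed.

Lemma has_steps_parallel_full s n :
  has_steps (parallel_innermost_step R) s n -> has_steps (full_step R) s n.
Proof.
elim: n s => [|n IH] s; first by exists s.
move=> [t [u [/parallel_innermost_step_full[m su] ut]]].
have un : has_steps (full_step R) u n by apply: IH; exists t.
(* A parallel step may yield several full steps; the surplus is cut off. *)
by apply: has_steps_leq (has_steps_trans su un); rewrite addSn ltnS leq_addl.
Qed.

(** The height depends only on the set of attainable lengths, and the inclusions from full to
    innermost to parallel and back to full close a cycle. *)
Lemma dh_full_parallel : dh (full_step R) = dh (parallel_innermost_step R).
Proof.
apply/funext => t; congr (esup (image _ _)); apply/seteqP; split=> m /=.
  by move=> /has_steps_full_innermost/has_steps_innermost_parallel.
exact: has_steps_parallel_full.
Qed.

End Innermost.

Theorem theorem5p11 (F : signature) (R : trs F)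
    (R_non_overlapping : non_overlapping R) (R_right_linear : right_linear R) :
  dc (full_step R) = dc (parallel_innermost_step R) /\
  rc R (full_step R) = rc R (parallel_innermost_step R).
Proof.
by rewrite /dc /rc (dh_full_parallel R_non_overlapping R_right_linear).
Qed.
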